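(* Let $k$ be a positive integer and let $p$ be a prime with $p\equiv 3 \pmod 4$. Let $r$ be a non-negative integer such that $p$ divides $4r+3$. Then for all integers $n\geq 0$, $$\bar{B}_{5,2}\left(4p^{k+1}n+4pr+3p\right)\equiv f(p)\cdot \bar{B}_{5,2}\left(4p^{k-1}n+\frac{4r+3}{p}\right) \pmod 4,$$ where $f(p)=-1$ if $p\equiv 3,7 \pmod{20}$ and $f(p)=1$ if $p\equiv 11,19 \pmod{20}$.
   Context: An overpartition of a positive integer $n$ is a partition of $n$ in which the first occurrence of each distinct part may be overlined. For coprime integers $\ell_1,\ell_2>1$, $\bar{B}_{\ell_1,\ell_2}(n)$ denotes the number of overpartitions of $n$ in which no part is divisible by $\ell_1$ or by $\ell_2$, with $\bar{B}_{\ell_1,\ell_2}(0)=1$. *)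

(* Defs.v *)
From mathcomp Require Import all_boot all_order all_algebra.

Set Implicit Arguments.
Unset Strict Implicit.
Unset Printing Implicit Defensive.

(* An overpartition is written in nonincreasing order as a list of pairs
   (part, overlined?). The last condition says that an overlined entry sits at
   the first occurrence of its part. *)
Definition is_overpartition (n : nat) (s : seq (nat * bool)) : bool :=
  let parts := unzip1 s in
  [&& sorted geq parts,
      all (fun a => 0 < a) parts,
      sumn parts == n &
      all (fun i => nth false (unzip2 s) i ==> (index (nth 0 parts i) parts == i))
          (iota 0 (size s))].

Definition forget_bounds (n : nat) (s : n.-bseq ('I_n.+1 * bool)) :
  seq (nat * bool) := [seq (nat_of_ord x.1, x.2) | x <- s].

(* An overpartition of n has at most n parts, each at most n, so bounded
   sequences with entries in 'I_n.+1 * bool lose nothing: see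
   forget_bounds_inj and forget_bounds_surj. *)
Definition Bbar (l1 l2 n : nat) : nat :=
  #|[set s : n.-bseq ('I_n.+1 * bool) |
      is_overpartition n (forget_bounds s)
      && all (fun a => ~~ (l1 %| a) && ~~ (l2 %| a))
             (unzip1 (forget_bounds s))]|.

(* The value 0 is never reached for a prime p = 3 mod 4. *)
Definition f_sign (p : nat) : int :=
  if p %% 20 \in [:: 3; 7] then (-1)%R
  else if p %% 20 \in [:: 11; 19] then 1%R
  else 0%R.

Lemma forget_bounds_inj n : injective (@forget_bounds n).
Proof.
move=> s t st; apply: val_inj; apply: inj_map st => -[a b] [c d] /= [ac ->].
by congr pair; apply: val_inj.
Qed.

Lemma forget_bounds_surj n (s : seq (nat * bool)) :
  is_overpartition n s -> exists t : n.-bseq ('I_n.+1 * bool), forget_bounds t = s.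
Proof.
case/and4P=> _ pos /eqP sums _.
have szs : size s <= n.
  rewrite -sums; elim: s pos {sums} => //= -[a b] s IH /= /andP[a0 /IH].
  by move=> les; rewrite -add1n leq_add.
have les : all (fun x => x.1 < n.+1) s.
  rewrite -sums; elim: s {pos sums szs} => //= -[a b] s IH /=.
  rewrite ltnS leq_addr /=; apply: sub_all IH => x; rewrite !ltnS => /leq_trans.
  by apply; rewrite leq_addl.
have szt : size [seq (inord x.1 : 'I_n.+1, x.2) | x <- s] <= n.
  by rewrite size_map.
exists (Bseq szt); rewrite /forget_bounds /= -map_comp.
rewrite -[RHS]map_id; apply/eq_in_map => -[a b] /(allP les) /= an.
by rewrite inordK.
Qed.

(* Main.v *)
Require Import Defs.
From mathcomp Require Import all_boot all_order all_algebra.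
From mathcomp Require Import zify.

Set Implicit Arguments.
Unset Strict Implicit.
Unset Printing Implicit Defensive.

(** A partition with [m] distinct parts carries [2 ^ m] overpartitions, so modulo
    4 only the partitions with a single part size matter: for [n > 0],
    [Bbar l1 l2 n] is twice the number [C n] of divisors of [n] divisible by
    neither [l1] nor [l2].  The two arguments in the theorem are [N] and
    [p ^ 2 * N], and multiplication by [p] maps the admissible divisors of
    [p * N] not dividing [N] bijectively onto those of [p ^ 2 * N] not dividing
    [p * N]; hence [C (p ^ 2 * N)] and [C N] have the same parity.  Both sides
    being even, the sign [f_sign p] plays no role modulo 4. *)

(** * Overlinings of a fixed list of parts, encoded as sets of marked values *)

Section Overlining.

Variables (T : eqType) (x0 : T).
Implicit Types (l : seq T) (s : seq (T * bool)) (A : pred T).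

(** The last condition of [is_overpartition], over any type so that parts may also be ordinals. *)
Definition overlined_first s : bool :=
  all (fun i => nth false (unzip2 s) i
                ==> (index (nth x0 (unzip1 s) i) (unzip1 s) == i))
      (iota 0 (size s)).

Definition overline l A : seq (T * bool) :=
  [seq (nth x0 l i, A (nth x0 l i) && (index (nth x0 l i) l == i))
  | i <- iota 0 (size l)].

Lemma size_overline l A : size (overline l A) = size l.
Proof. by rewrite size_map size_iota. Qed.

Lemma unzip1_overline l A : unzip1 (overline l A) = l.
Proof. by rewrite /unzip1 -map_comp -/(mkseq _ _) mkseq_nth. Qed.

Lemma overlined_first_overline l A : overlined_first (overline l A).
Proof.
apply/allP => i; rewrite mem_iota /= add0n size_overline => il.
rewrite unzip1_overline /unzip2 -map_comp (nth_map 0) ?size_iota //.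
by rewrite nth_iota //= add0n; apply/implyP => /andP[].
Qed.

Lemma mem_overline l A a : ((a, true) \in overline l A) = (a \in l) && A a.
Proof.
apply/mapP/andP => [[i]|[al Aa]].
  by rewrite mem_iota /= add0n => il [-> /esym/andP[Aa _]]; rewrite mem_nth.
exists (index a l); first by rewrite mem_iota /= add0n index_mem.
by rewrite nth_index // Aa eqxx.
Qed.

(** A mark can only sit at the first occurrence of its value, so the set of marked values determines
    every mark. *)
Lemma overlineK s : overlined_first s ->
  overline (unzip1 s) (fun a => (a, true) \in s) = s.
Proof.
move=> /allP firsts.
have mark i : i < size s -> (nth (x0, false) s i).2 ->
    index (nth (x0, false) s i).1 (unzip1 s) = i.
  move=> si; have := firsts i; rewrite mem_iota /= add0n => /(_ si)/implyP.
  rewrite (nth_map (x0, false)) // (nth_map (x0, false)) //.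
  by move=> H /H /eqP.
apply: (@eq_from_nth _ (x0, false)); rewrite size_overline size_map // => i si.
rewrite (nth_map 0) ?size_iota ?size_map // nth_iota ?size_map // add0n.
rewrite (nth_map (x0, false)) //.
rewrite [RHS]surjective_pairing; congr pair.
(* If the value at [i] is marked at [j], then [j] is its first occurrence; when [i] is one too,
   [i = j]. *)
apply/andP/idP => [[/(nthP (x0, false))[j sj ej] /eqP ei]|bi].
  by have := mark j sj; rewrite ej /= ei => /(_ isT) ->; rewrite ej.
split; last by rewrite mark.
by rewrite -bi -surjective_pairing mem_nth.
Qed.

End Overlining.

(** * From overpartitions to partitions and divisors *)

Definition is_restricted_partition (l1 l2 n : nat) (l : seq nat) : bool :=
  [&& sorted geq l, all (fun a => 0 < a) l, sumn l == n &
      all (fun a => ~~ (l1 %| a) && ~~ (l2 %| a)) l].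

Definition restricted_partitions (l1 l2 n : nat) : {set n.-bseq 'I_n.+1} :=
  [set L : n.-bseq 'I_n.+1 | is_restricted_partition l1 l2 n (map val L)].

Definition restricted_divisors (l1 l2 n : nat) : seq nat :=
  [seq d <- divisors n | ~~ (l1 %| d) && ~~ (l2 %| d)].

Lemma unzip1_forget_bounds n (s : n.-bseq ('I_n.+1 * bool)) :
  unzip1 (forget_bounds s) = map val (unzip1 s).
Proof. by rewrite /forget_bounds /unzip1 -!map_comp. Qed.

Lemma unzip2_forget_bounds n (s : n.-bseq ('I_n.+1 * bool)) :
  unzip2 (forget_bounds s) = unzip2 s.
Proof. by rewrite /forget_bounds /unzip2 -!map_comp. Qed.

Lemma overpartition_unzip1 l1 l2 n (s : n.-bseq ('I_n.+1 * bool)) :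
  is_overpartition n (forget_bounds s)
    && all (fun a => ~~ (l1 %| a) && ~~ (l2 %| a)) (unzip1 (forget_bounds s))
  = is_restricted_partition l1 l2 n (map val (unzip1 s))
    && overlined_first ord0 s.
Proof.
rewrite /is_overpartition /is_restricted_partition unzip1_forget_bounds.
rewrite unzip2_forget_bounds size_map.
have -> : overlined_first ord0 s =
    all (fun i => nth false (unzip2 s) i ==>
       (index (nth 0 (map val (unzip1 s)) i) (map val (unzip1 s)) == i))
       (iota 0 (size s)).
  apply: eq_in_all => i; rewrite mem_iota /= add0n => si.
  rewrite (nth_map ord0) ?size_map // index_map //; exact: val_inj.
by rewrite -!andbA; do 3!congr andb; rewrite andbC.
Qed.

(** An overpartition amounts to a pair of a partition [L] and a subset of its distinct parts, namely
    the overlined ones. *)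
Lemma Bbar_sum l1 l2 n :
  Bbar l1 l2 n =
  \sum_(L in restricted_partitions l1 l2 n) 2 ^ #|[set x in (L : seq _)]|.
Proof.
rewrite /Bbar.
pose pairing (s : n.-bseq ('I_n.+1 * bool)) : n.-bseq 'I_n.+1 * {set 'I_n.+1} :=
  ([bseq of map fst s], [set a | (a, true) \in (s : seq _)]).
set S := [set s | _].
have injS : {in S &, injective pairing}.
  move=> s t; rewrite !inE !overpartition_unzip1.
  move=> /andP[_ fs] /andP[_ ft] [st1 st2].
  apply: val_inj; rewrite -[val s](overlineK fs) -[val t](overlineK ft).
  have -> : unzip1 t = unzip1 s by rewrite /unzip1 st1.
  apply: eq_map => i; congr (_, _ && _).
  by move/setP: st2 => /(_ (nth ord0 (unzip1 s) i)); rewrite !inE.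
rewrite -(card_in_imset injS).
(* Each power of 2 becomes a count of subsets, so that the sum counts pairs [(L, A)]. *)
under eq_bigr do rewrite -card_powerset.
under eq_bigr do rewrite -sum1_card.
rewrite pair_big_dep /= -sum1_card; apply: eq_bigl => -[L A] /=.
rewrite inE powersetE; apply/imsetP/andP => [[s] | [LP AL]].
  rewrite inE overpartition_unzip1 => /andP[sP _] [-> ->]; split=> //.
  by apply/subsetP => a; rewrite !inE => /(map_f fst).
have sz : size (overline ord0 L (mem A)) <= n.
  by rewrite size_overline size_bseq.
exists (Bseq sz).
  by rewrite inE overpartition_unzip1 unzip1_overline overlined_first_overline
     andbT.
congr pair; first by apply: val_inj; rewrite /= -/(unzip1 _) unzip1_overline.
apply/setP => a; rewrite inE mem_overline /=.
by move/subsetP: AL => /(_ a); rewrite inE; case: (a \in A) => [->|_];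
   rewrite ?andbF.
Qed.

(** With a single part size [d], the partition must be [n %/ d] copies of [d], and each admissible
    divisor [d] occurs. *)
Lemma card_constant_partitions l1 l2 n : 0 < n ->
  #|[set L in restricted_partitions l1 l2 n | #|[set x in (L : seq _)]| == 1]|
  = size (restricted_divisors l1 l2 n).
Proof.
move=> n0; set S := [set L in _ | _].
pose part (L : n.-bseq 'I_n.+1) : nat := head 0 (map val L).
have constS L : L \in S -> exists d : 'I_n.+1,
    [/\ val L = nseq (n %/ d) d, val d %| n, 0 < d
      & ~~ (l1 %| d) && ~~ (l2 %| d)].
  rewrite !inE => /andP[/and4P[_ pos /eqP sumL ok] /cards1P[d Ld]].
  have Lnseq : val L = nseq (size L) d.
    apply/all_pred1P/allP => x xL; move/setP: Ld => /(_ x).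
    by rewrite !inE xL => /esym.
  have sL : size L * d = n.
    by move: sumL; rewrite Lnseq map_nseq sumn_nseq size_nseq mulnC.
  have L0 : 0 < size L.
    by rewrite lt0n; apply: contraTneq n0 => L0; rewrite -sL L0.
  have dL : val d \in map val L.
    by rewrite Lnseq map_nseq mem_nseq L0 eqxx.
  have d0 := allP pos _ dL.
  exists d; split=> //; last exact: (allP ok _ dL).
    by have := mulnK (size L) d0; rewrite sL => ->.
  by apply/dvdnP; exists (size L).
have partE (L : n.-bseq 'I_n.+1) (d : 'I_n.+1) :
    val L = nseq (n %/ d) d -> val d %| n -> 0 < d -> part L = d.
  move=> Ld dn d0; rewrite /part Ld map_nseq.
  have : 0 < n %/ d by rewrite divn_gt0 // dvdn_leq.
  by case: (n %/ d).
rewrite cardE -(size_map part); apply/perm_size/uniq_perm.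
- rewrite map_inj_in_uniq ?enum_uniq // => L M.
  rewrite !mem_enum => /constS[d [Ld dn d0 _]] /constS[e [Me en e0 _]].
  rewrite (partE _ _ Ld dn d0) (partE _ _ Me en e0) => /val_inj de.
  by apply: val_inj; rewrite Ld Me de.
- by rewrite filter_uniq ?divisors_uniq.
move=> a; rewrite mem_filter -dvdn_divisors //.
apply/mapP/andP => [[L]|[ok an]].
  by rewrite mem_enum => /constS[d [Ld dn d0 ok]] ->; rewrite (partE _ _ Ld dn d0).
have a0 : 0 < a by apply: dvdn_gt0 an.
have aS : a < n.+1 by rewrite ltnS dvdn_leq.
have na0 : 0 < n %/ a by rewrite divn_gt0 // dvdn_leq.
have sz : size (nseq (n %/ a) (Ordinal aS)) <= n.
  by rewrite size_nseq leq_div.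
exists (Bseq sz); last by rewrite (partE _ (Ordinal aS)).
rewrite mem_enum !inE /is_restricted_partition /= map_nseq /= !all_nseq a0 ok.
rewrite !orbT sumn_nseq mulnC divnK // eqxx !andbT; apply/andP; split.
  elim: (n %/ a) {na0 sz} => //= -[|m] //= IH.
  by rewrite leqnn.
apply/cards1P; exists (Ordinal aS); apply/setP => x.
by rewrite !inE mem_nseq na0.
Qed.

(** In [Bbar_sum], a partition with one part size contributes 2, any other a multiple of 4. *)
Lemma Bbar_mod4 l1 l2 n : 0 < n ->
  Bbar l1 l2 n = 2 * size (restricted_divisors l1 l2 n) %[mod 4].
Proof.
move=> n0; rewrite Bbar_sum -card_constant_partitions // -sum1_card big_distrr /=.
rewrite (bigID (fun L : n.-bseq _ => #|[set x in (L : seq _)]| == 1)) /=.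
rewrite addnC -modnDml; set rest := (X in X %% 4 + _).
have /eqP -> : 4 %| rest.
  apply: dvdn_sum => L /andP[]; rewrite inE => /and4P[_ _ /eqP sumL _] nL.
  suff: 1 < #|[set x in (L : seq _)]| by move=> H; apply: (@dvdn_exp2l 2 2).
  (* Since [n > 0], the partition is nonempty; having not exactly one part size, it has at least
     two. *)
  rewrite ltn_neqAle eq_sym nL card_gt0; apply/set0Pn.
  case: (val L) sumL n0 => [<-|x l] // _ _.
  by exists x; rewrite !inE eqxx.
rewrite add0n; congr (_ %% 4); apply: eq_big => [L|L /andP[_ /eqP->]] //.
by rewrite !inE.
Qed.

(** * Admissible divisors under multiplication by [p] *)

Section DivisorParity.

Variables (l1 l2 p : nat).
Hypotheses (p_prime : prime p) (cop1 : coprime l1 p) (cop2 : coprime l2 p).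

(** For [m > 0], these are the admissible divisors that contain the full power of [p] in [p * m]. *)
Definition new_divisors (m : nat) : seq nat :=
  [seq d <- restricted_divisors l1 l2 (p * m) | ~~ (d %| m)].

Lemma size_restricted_divisors_mul m : 0 < m ->
  size (restricted_divisors l1 l2 (p * m))
  = size (restricted_divisors l1 l2 m) + size (new_divisors m).
Proof.
move=> m0; have pm0 : 0 < p * m by rewrite muln_gt0 prime_gt0.
rewrite -(count_predC (fun d => d %| m)) -!size_filter; congr (_ + _).
apply/perm_size/uniq_perm; rewrite ?filter_uniq ?divisors_uniq // => d.
rewrite !mem_filter -!dvdn_divisors // [in RHS]andbC.
by case dm: (d %| m); rewrite ?andbF //= dvdn_mull ?andbT.
Qed.

Lemma size_new_divisors_mul m : 0 < m ->
  size (new_divisors (p * m)) = size (new_divisors m).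
Proof.
move=> m0; have p0 := prime_gt0 p_prime.
have pm0 : 0 < p * m by rewrite muln_gt0 p0.
rewrite -[RHS](size_map (muln p)); apply/perm_size/uniq_perm.
- by rewrite !filter_uniq ?divisors_uniq.
- rewrite map_inj_uniq ?filter_uniq ?divisors_uniq // => a b /eqP.
  by rewrite eqn_pmul2l // => /eqP.
move=> d; apply/idP/mapP => [|[e]]; rewrite !mem_filter -!dvdn_divisors ?muln_gt0 ?p0 //.
  case/and3P=> dpm ok dppm.
  (* Otherwise [d] is coprime to [p], and dividing [p * (p * m)] it would divide [p * m]. *)
  have pd : p %| d.
    apply: contraNT dpm => pd; move: dppm; rewrite Gauss_dvdr //.
    by rewrite coprime_sym prime_coprime.
  case/dvdnP: pd => e; rewrite mulnC => de; exists e => //; subst d.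
  rewrite !mem_filter -dvdn_divisors //.
  move: dpm ok dppm; rewrite !dvdn_pmul2l // (Gauss_dvdr _ cop1).
  by rewrite (Gauss_dvdr _ cop2) => -> -> ->.
case/and3P=> em ok epm ->.
by rewrite !dvdn_pmul2l // (Gauss_dvdr _ cop1) (Gauss_dvdr _ cop2) em ok.
Qed.

Lemma size_restricted_divisors_sq m : 0 < m ->
  size (restricted_divisors l1 l2 (p * (p * m)))
  = size (restricted_divisors l1 l2 m) + 2 * size (new_divisors m).
Proof.
move=> m0; have pm0 : 0 < p * m by rewrite muln_gt0 prime_gt0.
rewrite !size_restricted_divisors_mul // size_new_divisors_mul //.
by rewrite -addnA addnn mul2n.
Qed.

(** The divisor count changes by an even number, and [Bbar] is twice that count modulo 4. *)
Lemma Bbar_sq_mod4 m : 0 < m ->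
  Bbar l1 l2 (p * (p * m)) = Bbar l1 l2 m %[mod 4].
Proof.
move=> m0; have p0 := prime_gt0 p_prime.
rewrite !Bbar_mod4 ?muln_gt0 ?p0 // size_restricted_divisors_sq //; lia.
Qed.

End DivisorParity.

(** * The sign and the final congruence *)

Lemma Bbar_even l1 l2 n : 0 < n -> 2 %| Bbar l1 l2 n.
Proof.
move=> n0; have /eqP := Bbar_mod4 l1 l2 n0; lia.
Qed.

(** Modulo 20, [p] is 3, 7, 11, 15 or 19; the residue 15 would force [p = 5], which is 1 modulo
    4. *)
Lemma f_sign_odd p : prime p -> p = 3 %[mod 4] ->
  f_sign p = 1%R \/ f_sign p = (-1)%R.
Proof.
move=> p_prime p3; rewrite /f_sign.
have p5 : p %% 5 != 0.
  apply: contraL p_prime => p5; apply/negP => p_prime.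
  have /(prime_nt_dvdP p_prime) : 5 %| p by [].
  by move=> /(_ isT) e; rewrite -e in p3.
suff : p %% 20 \in [:: 3; 7; 11; 19].
  rewrite !inE; case: (p %% 20 == 3); first by right.
  case: (p %% 20 == 7); first by right.
  by case: (p %% 20 == 11) => //=; [left | move=> ->; left].
rewrite !inE; lia.
Qed.

Unset Implicit Arguments.

Theorem theorem5p4 (k p r n : nat) :
  0 < k -> prime p -> p = 3 %[mod 4] -> p %| 4 * r + 3 ->
  ((Bbar 5 2 (4 * p ^ (k + 1) * n + 4 * p * r + 3 * p))%:Z =
   f_sign p * (Bbar 5 2 (4 * p ^ (k - 1) * n + (4 * r + 3) %/ p)%N)%:Z
     %[mod 4])%Z.
Proof.
case: k => // k _ p_prime p3 /dvdnP[q rq].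
have p0 := prime_gt0 p_prime.
rewrite rq mulnK // subn1 addn1 /=; set N := 4 * p ^ k * n + q.
have -> : 4 * p ^ k.+2 * n + 4 * p * r + 3 * p = p * (p * N).
  rewrite -addnA (_ : 4 * p * r + 3 * p = p * (4 * r + 3)) ?rq /N; last by lia.
  by rewrite !expnS; lia.
(* Here [q] is nonzero because [q * p = 4 * r + 3]. *)
have N0 : 0 < N by rewrite addn_gt0; case: (q) rq => [|?]; lia.
have copr l : prime l -> l %% 4 != 3 -> coprime l p.
  move=> l_prime l3; rewrite prime_coprime // dvdn_prime2 //.
  by apply: contraNneq l3 => ->; rewrite p3.
have := Bbar_sq_mod4 p_prime (copr 5 isT isT) (copr 2 isT isT) N0.
have := Bbar_even 5 2 N0.
move: (Bbar _ _ N) (Bbar _ _ (p * (p * N))) => b c.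
(* As [b] is even, [b] and [-b] agree modulo 4. *)
by case: (f_sign_odd p_prime p3) => -> b2 bc; lia.
Qed.
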